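(* For a pure state of $\mathcal{H}=\mathcal{H}_1\otimes\cdots\otimes\mathcal{H}_m$, let $a_k$ be the number of product states in the range of the reduced density matrix obtained by tracing out $\mathcal{H}_k$, and write that the state is in $[a_1,a_2,\ldots,a_m]$. Then (1) $|\Psi_N\rangle\sim|\Phi_N\rangle\in[1,1,\ldots,1]$; (2) $|GHZ_{(r)}\rangle\in[r,r,\ldots,r]$; (3) $|\Phi_N\rangle+\sum_{n=N+1}^{N+r}|n\rangle^{\otimes m}\in[r+1,r+1,\ldots,r+1]$. Consequently each of these representatives is SLOCC-inequivalent to the other, even if they have the same Schmidt rank. For example, the Schmidt rank of $|GHZ_{(M)}\rangle$, $|\Psi_{M-1}\rangle$ and $|\Phi_{M-2}\rangle+|M-1\rangle^{\otimes m}$ is $M$, but they are respectively in $[M,M,\ldots,M]$, $[1,1,\ldots,1]$ and $[2,2,\ldots,2]$, and are thus SLOCC-inequivalent.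
   Context: The state space is $\mathcal{H}=\mathcal{H}_1\otimes\cdots\otimes\mathcal{H}_m$, the space of $m$ optical modes, each mode space $\mathcal{H}_k$ having orthonormal number basis $|0\rangle,|1\rangle,|2\rangle,\ldots$; write $|n_1\ldots n_m\rangle=|n_1\rangle\otimes\cdots\otimes|n_m\rangle$. A product state in $\bigotimes_{j\neq k}\mathcal{H}_j$ is one of the form $\bigotimes_{j\ne k}|v_j\rangle$; product states are counted as states, i.e. up to scalar multiples. For integers $n\ge0$ and $r\ge1$ define $$|\Psi_n\rangle=\frac{1}{m^{n/2}}\sum_{n_1+\cdots+n_m=n}\sqrt{\binom{n}{n_1,\ldots,n_m}}\,|n_1\ldots n_m\rangle,\qquad |\Phi_n\rangle=\sum_{n_1+\cdots+n_m=n}|n_1\ldots n_m\rangle,$$ $$|GHZ_{(r)}\rangle=\frac{1}{\sqrt r}\sum_{k=0}^{r-1}|k\rangle^{\otimes m},$$ where the first two sums run over all tuples of non-negative integers with sum $n$ and $\binom{n}{n_1,\ldots,n_m}=\frac{n!}{n_1!\cdots n_m!}$. Here $N\ge0$ and $r\ge1$ are integers. Two (possibly unnormalized) pure states $|\Psi\rangle,|\Phi\rangle$ are SLOCC-equivalent, written $|\Psi\rangle\sim|\Phi\rangle$, if there are invertible local operators $A_k$ on $\mathcal{H}_k$, $k=1,\ldots,m$, with $|\Phi\rangle=A_1\otimes\cdots\otimes A_m|\Psi\rangle$; otherwise they are SLOCC-inequivalent. The Schmidt rank with respect to a bipartition of the modes is the rank of the coefficient matrix of the state for that bipartition; for the states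 above it does not depend on the bipartition.
   Formalization: Assumes m ≥ 3 (for m = 2 the product-state counts fail) and M ≥ 2; inequivalence is not claimed for pairs equal up to a scalar: Φ_0 = Ψ_0 = GHZ_(1), and Φ_0 + Σ_{n=1}^{r}|n⟩^{⊗m} ∝ GHZ_(r+1), so in the example GHZ_(M) versus Φ_{M-2}+|M-1⟩^{⊗m} needs M ≥ 3. *)

(* Defs.v *)
From HB Require Import structures.
From mathcomp Require Import all_boot all_order all_algebra.
From mathcomp Require Import complex.
From mathcomp Require Import all_classical all_reals all_analysis.

Set Implicit Arguments.
Unset Strict Implicit.
Unset Printing Implicit Defensive.

Import Order.TTheory GRing.Theory Num.Theory.
Local Open Scope classical_set_scope.
Local Open Scope card_scope.
Local Open Scope complex_scope.
Local Open Scope ring_scope.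

(* Every Hilbert space is realised as l^2(T) for the index type T of its
   orthonormal basis, a vector being its family of coefficients T -> R[i]:
     - a single mode is l^2(nat), in the number basis;
     - the tensor product of the modes indexed by a finite type I is
       l^2({ffun I -> nat}), in the basis |n_1 ... n_m>.
   Membership in the Hilbert space is the predicate l2; an operator is a
   total function on families of which only the action on l2 matters. *)

Section Hilbert.
Variable R : realType.
Local Notation C := R[i].

Definition sqnorm (T : choiceType) (x : T -> C) : \bar R :=
  \esum_(t in [set: T]) ((complex.Re (x t)) ^+ 2 + (complex.Im (x t)) ^+ 2)%:E.

Definition l2 (T : choiceType) (x : T -> C) : Prop := (sqnorm x < +oo)%E.

(* Unordered sums; meaningful for absolutely summable families only. *)
Definition rsum (T : choiceType) (f : T -> R) : R :=
  fine (\esum_(t in [set: T]) ((EFin \o f)^\+)%E t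
        - \esum_(t in [set: T]) ((EFin \o f)^\-)%E t)%E.

Definition csum (T : choiceType) (f : T -> C) : C :=
  rsum (fun t => complex.Re (f t)) +i* rsum (fun t => complex.Im (f t)).

Definition bounded_operator (T U : choiceType) (F : (T -> C) -> (U -> C)) : Prop :=
  [/\ forall x, l2 x -> l2 (F x),
      forall (c : C) x y, l2 x -> l2 y ->
        F (fun t => c * x t + y t) = (fun u => c * F x u + F y u) &
      exists M : R, forall x, l2 x -> (sqnorm (F x) <= M%:E * sqnorm x)%E].

Definition invertible_operator (T : choiceType) (F : (T -> C) -> (T -> C)) : Prop :=
  bounded_operator F /\
  exists G : (T -> C) -> (T -> C), bounded_operator G /\
    forall x, l2 x -> F (G x) = x /\ G (F x) = x.

Definition ray (T : Type) (x : T -> C) : set (T -> C) :=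
  [set y | exists2 c : C, c != 0 & y = (fun t => c * x t)].

End Hilbert.

Section Modes.
Variables (R : realType) (I : finType).
Local Notation C := R[i].

Definition tensor (v : I -> nat -> C) : {ffun I -> nat} -> C :=
  fun a => \prod_(j : I) v j (a j).

(* F is A_1 (x) ... (x) A_m: the bounded operator on the tensor product whose
   action on product vectors, a total subset, is the prescribed one. *)
Definition is_tensor_operator (A : I -> (nat -> C) -> (nat -> C))
    (F : ({ffun I -> nat} -> C) -> ({ffun I -> nat} -> C)) : Prop :=
  bounded_operator F /\
  forall v : I -> nat -> C, (forall j, l2 (v j)) ->
    F (tensor v) = tensor (fun j => A j (v j)).

Definition slocc (psi phi : {ffun I -> nat} -> C) : Prop :=
  exists A : I -> (nat -> C) -> (nat -> C),
    (forall j, invertible_operator (A j)) /\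
    exists2 F, is_tensor_operator A F & phi = F psi.

Definition is_product (x : {ffun I -> nat} -> C) : Prop :=
  exists2 v : I -> nat -> C, forall j, l2 (v j) & x = tensor v.

Definition merge_modes (S : {set I}) (a : {ffun {j : I | j \in S} -> nat})
    (b : {ffun {j : I | j \in ~: S} -> nat}) : {ffun I -> nat} :=
  [ffun j => match insub j : option {j : I | j \in S},
                   insub j : option {j : I | j \in ~: S} with
             | Some u, _ => a u
             | None, Some u => b u
             | None, None => 0%N
             end].

(* Coefficient matrix of psi for the bipartition S | ~: S. *)
Definition coef_matrix (S : {set I}) (psi : {ffun I -> nat} -> C)
    (a : {ffun {j : I | j \in S} -> nat})
    (b : {ffun {j : I | j \in ~: S} -> nat}) : C := psi (merge_modes a b).

(* Matrix elements of Tr_{~: S} |psi><psi|, an operator on the modes in S. *)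
Definition reduced_density (S : {set I}) (psi : {ffun I -> nat} -> C)
    (a b : {ffun {j : I | j \in S} -> nat}) : C :=
  csum (fun c => coef_matrix psi a c * (coef_matrix psi b c)^*%R).

Definition reduced_range (S : {set I}) (psi : {ffun I -> nat} -> C) :
    set ({ffun {j : I | j \in S} -> nat} -> C) :=
  [set y | exists2 x, l2 x &
    y = (fun a => csum (fun b => reduced_density psi a b * x b))].

End Modes.

Section Classes.
Variables (R : realType) (I : finType).
Local Notation C := R[i].

Definition product_states (S : {set I}) (psi : {ffun I -> nat} -> C) :
    set (set ({ffun {j : I | j \in S} -> nat} -> C)) :=
  [set ray x | x in [set x | [/\ @reduced_range R I S psi x,
                                 is_product x & exists a, x a != 0]]].

(* psi is in [a_1, ..., a_m]. *)
Definition in_class (psi : {ffun I -> nat} -> C) (a : I -> nat) : Prop :=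
  forall k : I, @product_states (~: [set k])%SET psi #= `I_(a k).

(* Rank of a possibly infinite matrix: r linearly independent columns span
   all the columns. *)
Definition has_rank (T U : Type) (M : T -> U -> C) (r : nat) : Prop :=
  exists col : 'I_r -> U,
    (forall c : 'I_r -> C,
       (forall t, \sum_(i < r) c i * M t (col i) = 0) -> forall i, c i = 0) /\
    (forall u, exists c : 'I_r -> C,
       forall t, M t u = \sum_(i < r) c i * M t (col i)).

(* The Schmidt rank is r for every bipartition into two nonempty parts. *)
Definition has_schmidt_rank (psi : {ffun I -> nat} -> C) (r : nat) : Prop :=
  forall S : {set I}, S != finset.set0 -> S != finset.setT ->
    has_rank (@coef_matrix R I S psi) r.

End Classes.

Section Representatives.
Variables (R : realType) (m : nat).
Local Notation C := R[i].

Definition ket (n : nat) : nat -> C := fun k => (k == n)%:R.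

Definition fock (n : 'I_m -> nat) : {ffun 'I_m -> nat} -> C :=
  tensor (fun j => ket (n j)).

Definition ket_pow (n : nat) : {ffun 'I_m -> nat} -> C := fock (fun=> n).

(* Entries of a tuple of sum n are at most n, so the tuples summed over are
   functions into 'I_n.+1. *)
Definition Psi (n : nat) : {ffun 'I_m -> nat} -> C := fun a =>
  ((m%:R `^ (n%:R / 2%:R))^-1)%:C *
  \sum_(t : {ffun 'I_m -> 'I_n.+1} | (\sum_j t j)%N == n)
    (Num.sqrt (n`!%:R / (\prod_j (t j)`!)%:R))%:C * fock (fun j => t j) a.

Definition Phi (n : nat) : {ffun 'I_m -> nat} -> C := fun a =>
  \sum_(t : {ffun 'I_m -> 'I_n.+1} | (\sum_j t j)%N == n) fock (fun j => t j) a.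

Definition GHZ (r : nat) : {ffun 'I_m -> nat} -> C := fun a =>
  ((Num.sqrt r%:R)^-1)%:C * \sum_(0 <= k < r) ket_pow k a.

Definition PhiGHZ (N r : nat) : {ffun 'I_m -> nat} -> C := fun a =>
  Phi N a + \sum_(N.+1 <= n < (N + r).+1) ket_pow n a.

End Representatives.

(* Main.v *)
Require Import Defs.
From HB Require Import structures.
From mathcomp Require Import all_boot all_order all_algebra.
From mathcomp Require Import complex.
From mathcomp Require Import lra ring zify.
From mathcomp Require Import all_classical all_reals all_analysis.

Import Order.TTheory GRing.Theory Num.Theory.
Local Open Scope ring_scope.

(* All representatives have finitely many Schmidt vectors, each with finite
   support, so the range of a reduced density matrix is the span of the Schmidt
   vectors on the remaining modes.  If phi = (A_1 (x) ... (x) A_m) psi, the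
   vectors A_j |n> are linearly independent for n < K and hence have a dual
   family of finitely supported functionals.  So A (x) ... (x) A maps a Schmidt
   decomposition of psi to one of phi and has a left inverse which, like it,
   preserves product vectors: the Schmidt rank and the number of product states
   are SLOCC invariants.

   Up to a scalar and a nonvanishing product weight prod_j h(a_j), every
   representative is Phi_N + sum_(n = N+1)^(N+r) |n ... n>, of Schmidt rank
   N + r + 1 and with r + 1 product states: the nonzero coefficients of a product
   vector form a rectangle, and the only rectangles compatible with the span of
   Phi_0, ..., Phi_N, |n ... n> are |0 ... 0> and the |n ... n>.  The two
   invariants determine (N, r). *)

(** * Rank decompositions *)

Section Separation.
Local Set Implicit Arguments.
Local Unset Strict Implicit.
Variable F : fieldType.

(** Linear independence witnessed by dual functionals that are finite combinations [P i] of point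
    evaluations. In this form it can be composed with explicit linear maps. *)
Definition separated_family (T : Type) (r : nat) (f : 'I_r -> T -> F) : Prop :=
  exists (J : finType) (pt : J -> T) (P : 'I_r -> J -> F),
    forall i k, \sum_j P i j * f k (pt j) = (i == k)%:R.

Lemma separated_free (T : Type) (r : nat) (f : 'I_r -> T -> F)
    (c : 'I_r -> F) :
  separated_family f -> (forall t, \sum_i c i * f i t = 0) -> forall i, c i = 0.
Proof.
move=> [J [pt [P fP]]] c0 i.
have: \sum_j P i j * \sum_k c k * f k (pt j) = 0.
  by rewrite big1// => j _; rewrite c0 mulr0.
under eq_bigr do rewrite mulr_sumr.
rewrite exchange_big/= (bigD1 i)//= [X in _ + X]big1 ?addr0 => [<-|k ki].
  under eq_bigr do rewrite mulrCA.
  by rewrite -mulr_sumr fP eqxx mulr1.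
under eq_bigr do rewrite mulrCA.
by rewrite -mulr_sumr fP eq_sym (negPf ki) mulr0.
Qed.

(* A finite evaluation matrix of maximal rank has full row rank: otherwise a
   vector of its left kernel survives every added evaluation point. *)
Lemma free_separated (T : Type) (r : nat) (f : 'I_r -> T -> F) :
  (forall c : 'I_r -> F,
     (forall t, \sum_i c i * f i t = 0) -> forall i, c i = 0) ->
  separated_family f.
Proof.
move=> f_free.
pose E n (pt : 'I_n -> T) : 'M[F]_(r, n) := \matrix_(i, j) f i (pt j).
have: exists n (pt : 'I_n -> T), row_free (E n pt).
  have [k [rk [n [pt kE]]] kmax] : exists2 k, (k <= r)%N /\
      (exists n (pt : 'I_n -> T), \rank (E n pt) = k) &
      forall n (pt : 'I_n -> T), (\rank (E n pt) <= k)%N.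
    pose Q k := `[< exists n (pt : 'I_n -> T), \rank (E n pt) = k >].
    have exQ : exists k, Q k.
      have pt0 : 'I_0 -> T by case.
      by exists (\rank (E 0%N pt0)); apply/asboolP; exists 0%N, pt0.
    have Qle k : Q k -> (k <= r)%N.
      by move=> /asboolP[n [pt <-]]; exact: rank_leq_row.
    case: (ex_maxnP exQ Qle) => k Qk kmax.
    exists k; first by split; [exact: Qle | apply/asboolP].
    by move=> n pt; apply: kmax; apply/asboolP; exists n, pt.
  exists n, pt; rewrite -kermx_eq0; apply/eqP/row_matrixP => l; rewrite row0.
  set u := row l (kermx (E n pt)).
  apply/rowP => i; rewrite [RHS]mxE; move: i.
  apply: (f_free (fun i => u ord0 i)) => t.
  pose pt' (j : 'I_(n + 1)) := match fintype.split j with inl j => pt j | _ => t end.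
  have EE : E _ pt' = row_mx (E n pt) (\col_i f i t).
    apply/matrixP => a b; rewrite !mxE /pt'.
    by case: fintype.splitP => b' _; rewrite !mxE.
  have ker_le : (kermx (E _ pt') <= kermx (E n pt))%MS.
    apply/sub_kermxP; have /sub_kermxP := submx_refl (kermx (E _ pt')).
    rewrite {2}EE mul_mx_row -[0 in X in X -> _]row_mx0.
    by move=> /eq_row_mx[].
  have ker_ge : (kermx (E n pt) <= kermx (E _ pt'))%MS.
    rewrite -(mxrank_leqif_sup ker_le).2 eqn_leq mxrankS//= !mxrank_ker.
    by rewrite leq_sub2l// kE.
  have /sub_kermxP : (u <= kermx (E _ pt'))%MS.
    exact: submx_trans (row_sub _ _) ker_ge.
  rewrite EE mul_mx_row -[0 in X in X -> _]row_mx0 => /eq_row_mx[_].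
  move=> /matrixP/(_ ord0 ord0); rewrite !mxE => u0.
  rewrite -[RHS]u0; apply: eq_bigr => k' _; congr (_ * _).
  by rewrite mxE.
move=> [n [pt Efree]].
(* Full row rank gives the evaluation matrix a right inverse, whose columns are the dual
   functionals. *)
exists 'I_n, pt, (fun i j => pinvmx (E n pt) j i) => i k.
have /matrixP/(_ k i) := mulmxVp Efree.
rewrite !mxE eq_sym => <-.
by apply: eq_bigr => j _; rewrite [E _ _ _ _]mxE mulrC.
Qed.

(** A rank factorization, that is, an unnormalized Schmidt decomposition: independence takes the
    place of orthogonality. *)
Definition decomposes (T U : Type) (M : T -> U -> F) (r : nat)
    (f : 'I_r -> T -> F) (g : 'I_r -> U -> F) : Prop :=
  [/\ forall t u, M t u = \sum_i f i t * g i u, separated_family f & separated_family g].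

(** The functionals dual to [g], applied along the second index, recover each [f i] as a combination
    of columns of [M], and all columns lie in the span of [f']. *)
Lemma decomposes_span (T U : Type) (M : T -> U -> F) r r' f g f' g' :
  @decomposes T U M r f g -> @decomposes T U M r' f' g' ->
  exists X : 'M[F]_(r, r'), forall i t, f i t = \sum_k X i k * f' k t.
Proof.
move=> [Mfg _ [J [pt [P gP]]]] [Mfg' _ _].
exists (\matrix_(i, k) \sum_j P i j * g' k (pt j)) => i t.
transitivity (\sum_j P i j * M t (pt j)).
  under [RHS]eq_bigr do rewrite Mfg mulr_sumr.
  rewrite exchange_big/= (bigD1 i)//= [X in _ + X]big1 ?addr0 => [|k ki].
    under eq_bigr do rewrite mulrCA.
    by rewrite -mulr_sumr gP eqxx mulr1.
  under eq_bigr do rewrite mulrCA.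
  by rewrite -mulr_sumr gP eq_sym (negPf ki) mulr0.
under eq_bigr do rewrite Mfg' mulr_sumr.
rewrite exchange_big/=; apply: eq_bigr => k _.
by rewrite mxE mulr_suml; apply: eq_bigr => j _; rewrite mulrA mulrAC.
Qed.

(** Applying the functionals dual to [f] to [f = X f'] gives [X Y = 1] with [X] of size r by r',
    which forces r <= r'. *)
Lemma decomposes_leq (T U : Type) (M : T -> U -> F) r r' f g f' g' :
  @decomposes T U M r f g -> @decomposes T U M r' f' g' -> (r <= r')%N.
Proof.
move=> Mfg Mfg'; have [X fX] := decomposes_span Mfg Mfg'.
have [_ [J [pt [P fP]]] _] := Mfg.
apply: (@mulmx1_min F r r' X (\matrix_(k, i) \sum_j P i j * f' k (pt j))).
apply/matrixP => k i; rewrite !mxE eq_sym -fP.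
under [LHS]eq_bigr do rewrite mxE mulr_sumr.
rewrite exchange_big/=; apply: eq_bigr => j _.
by rewrite fX mulr_sumr; apply: eq_bigr => l _; rewrite mulrCA.
Qed.

Definition lin_span (T : Type) (r : nat) (f : 'I_r -> T -> F) : set (T -> F) :=
  [set y | exists c : 'I_r -> F, y = (fun t => \sum_i c i * f i t)]%classic.

Lemma decomposes_eq_span (T U : Type) (M : T -> U -> F) r r' f g f' g' :
  @decomposes T U M r f g -> @decomposes T U M r' f' g' -> lin_span f = lin_span f'.
Proof.
have sub r1 r2 f1 g1 f2 g2 : @decomposes T U M r1 f1 g1 ->
    @decomposes T U M r2 f2 g2 -> (lin_span f1 `<=` lin_span f2)%classic.
  move=> D1 D2 y [c ->]; have [X fX] := decomposes_span D1 D2.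
  exists (fun k => \sum_i c i * X i k); apply/funext => t.
  under eq_bigr do rewrite fX mulr_sumr.
  rewrite exchange_big/=; apply: eq_bigr => k _.
  by rewrite mulr_suml; apply: eq_bigr => j _; rewrite mulrA.
move=> D1 D2; apply/seteqP; split; [exact: sub D1 D2 | exact: sub D2 D1].
Qed.

Lemma separated_diag (T : Type) (r : nat) (f : 'I_r -> T -> F)
    (pt : 'I_r -> T) (w : 'I_r -> F) :
  (forall i, w i != 0) -> (forall i k, f k (pt i) = (i == k)%:R * w i) ->
  separated_family f.
Proof.
move=> w0 fw; exists 'I_r, pt, (fun i j => (i == j)%:R * (w i)^-1) => i k.
rewrite (bigD1 i)//= big1 ?addr0 => [|j ji]; last first.
  by rewrite eq_sym (negPf ji) !mul0r.
by rewrite fw eqxx mul1r mulrCA mulVf ?mulr1.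
Qed.

End Separation.

(** * The range of a reduced density matrix *)

Section FiniteSums.
Local Set Implicit Arguments.
Local Unset Strict Implicit.
Variable R : realType.
Local Notation C := R[i].

Definition supported (T : eqType) (A : seq T) (x : T -> C) : Prop :=
  forall t, t \notin A -> x t = 0.

Lemma esum_seq (T : choiceType) (A : seq T) (h : T -> \bar R) :
  uniq A -> (forall t, 0%E <= h t)%E -> (forall t, t \notin A -> h t = 0%E) ->
  (\esum_(t in [set: T]) h t = \sum_(t <- A) h t)%E.
Proof.
move=> uA h0 hA.
transitivity (\esum_(t in [set` A]) h t)%E.
  rewrite [RHS]esum_mkcond; apply: eq_esum => t _.
  by case: ifPn => // /negP tA; rewrite hA//; apply/negP => At; apply: tA; rewrite inE.
by rewrite esum_fset// -fsbig_seq.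
Qed.

Lemma rsum_seq (T : choiceType) (A : seq T) (f : T -> R) :
  uniq A -> (forall t, t \notin A -> f t = 0) -> rsum f = \sum_(t <- A) f t.
Proof.
move=> uA fA; rewrite /rsum !(esum_seq uA)//.
- have -> : (\sum_(t <- A) ((EFin \o f)^\+) t = \sum_(t <- A) (Num.max (f t) 0)%:E)%E.
    by apply: eq_bigr => t _; rewrite funeposE/= EFin_max.
  have -> : (\sum_(t <- A) ((EFin \o f)^\-) t = \sum_(t <- A) (Num.max (- f t) 0)%:E)%E.
    by apply: eq_bigr => t _; rewrite funenegE/= EFin_max EFinN.
  rewrite !sumEFin -EFinB/= -sumrB; apply: eq_bigr => t _.
  by case: (leP (f t) 0) => ?; case: (leP (- f t) 0) => ?; lra.
- by move=> t /fA; rewrite funenegE/= => ->; rewrite oppr0 maxxx.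
- by move=> t /fA; rewrite funeposE/= => ->; rewrite maxxx.
Qed.

Lemma csum_seq (T : choiceType) (A : seq T) (f : T -> C) :
  uniq A -> supported A f -> csum f = \sum_(t <- A) f t.
Proof.
move=> uA fA; rewrite /csum !(rsum_seq uA); last 2 first.
- by move=> t /fA ->.
- by move=> t /fA ->.
have ReD : {morph @complex.Re R : x y / x + y} by move=> [? ?] [? ?].
have ImD : {morph @complex.Im R : x y / x + y} by move=> [? ?] [? ?].
rewrite -(big_morph (id2 := 0) _ ReD)// -(big_morph (id2 := 0) _ ImD)//.
by case: (\sum_(t <- A) f t).
Qed.

Lemma sqnorm_seq (T : choiceType) (A : seq T) (x : T -> C) :
  uniq A -> supported A x -> sqnorm x =
  (\sum_(t <- A) (complex.Re (x t) ^+ 2 + complex.Im (x t) ^+ 2))%:E.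
Proof.
move=> uA xA; rewrite /sqnorm (esum_seq uA) ?sumEFin//.
- by move=> t; rewrite lee_fin addr_ge0 ?sqr_ge0.
- by move=> t /xA -> /=; rewrite expr0n addr0.
Qed.

Lemma supported_l2 (T : choiceType) (A : seq T) (x : T -> C) :
  supported A x -> l2 x.
Proof.
move=> xA; rewrite /l2 (@sqnorm_seq _ (undup A)) ?undup_uniq ?ltry//.
by move=> t; rewrite mem_undup; exact: xA.
Qed.

(** With [M = sum_i f_i g_i], the coefficients of [rho x] on the [f_i] are the Gram matrix of [g]
    applied to the inner products of the [f_k] with [x]. The Gram matrix is invertible and these
    inner products can be prescribed freely, so the whole span is attained. *)
Lemma reduced_range_span (I : finType) (S : {set I})
    (psi : {ffun I -> nat} -> C) (r : nat) f g A B :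
  decomposes (@coef_matrix R I S psi) f g ->
  (forall i : 'I_r, supported A (f i)) -> (forall i, supported B (g i)) ->
  @reduced_range R I S psi = lin_span f.
Proof.
wlog : A B / uniq A /\ uniq B.
  move=> /(_ (undup A) (undup B)) H D fA gB; apply: H => //.
  - by rewrite !undup_uniq.
  - by move=> i t; rewrite mem_undup; exact: fA.
  - by move=> i t; rewrite mem_undup; exact: gB.
move=> [uA uB] [Mfg fS gS] fA gB.
set M := @coef_matrix R I S psi in Mfg *.
have MA a b : a \notin A -> M a b = 0.
  by move=> aA; rewrite Mfg big1// => i _; rewrite fA// mul0r.
have MB a b : b \notin B -> M a b = 0.
  by move=> bB; rewrite Mfg big1// => i _; rewrite gB// mulr0.
have rangeE x : (fun a => csum (fun b => reduced_density psi a b * x b)) =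
    (fun a => \sum_i (\sum_(b <- A) \sum_(c <- B) g i c * (M b c)^* * x b) * f i a).
  apply/funext => a; rewrite (csum_seq uA); last first.
    move=> b bA; rewrite /reduced_density (csum_seq uB) ?big1 ?mul0r// => [c _|c cB].
      by rewrite -/M (MA b)// conjC0 mulr0.
    by rewrite -/M MB// mul0r.
  under [RHS]eq_bigr do rewrite mulr_suml.
  rewrite exchange_big/=; apply: eq_bigr => b _.
  rewrite /reduced_density (csum_seq uB); last by move=> c cB; rewrite -/M MB// mul0r.
  rewrite mulr_suml; under [RHS]eq_bigr do rewrite mulr_suml.
  rewrite exchange_big/=; apply: eq_bigr => c _.
  rewrite -/M Mfg !mulr_suml; apply: eq_bigr => i _.
  by rewrite -!mulrA mulrC -!mulrA.
apply/seteqP; split => [y [x _ ->]|y [c ->]].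
  rewrite rangeE.
  by exists (fun i => \sum_(b <- A) \sum_(c <- B) g i c * (M b c)^* * x b).
pose G : 'M[C]_r := \matrix_(i, k) \sum_(c <- B) g i c * (g k c)^*.
have Gunit : G \in unitmx.
  rewrite -row_free_unit -kermx_eq0; apply/eqP/row_matrixP => l; rewrite row0.
  set u := row l (kermx G).
  have uG : u *m G = 0 by apply/sub_kermxP; exact: row_sub.
  apply/rowP => i; rewrite [RHS]mxE; move: i.
  apply: (separated_free gS) => t.
  have [tB|tB] := boolP (t \in B); last by rewrite big1// => i _; rewrite gB// mulr0.
  (* The form [u G conj(u)] is the squared norm of [sum_i u_i g_i]; a left kernel vector of [G]
     makes it zero, and independence of [g] then kills [u]. *)
  have : \sum_(c <- B) `|\sum_i u ord0 i * g i c| ^+ 2 = 0.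
    transitivity (\sum_k (u *m G) ord0 k * (u ord0 k)^*); last first.
      by rewrite uG big1// => k _; rewrite mxE mul0r.
    under [RHS]eq_bigr do rewrite mxE mulr_suml.
    under [RHS]eq_bigr => k _.
      under eq_bigr => i _ do rewrite [G _ _]mxE mulr_sumr mulr_suml.
      over.
    under [RHS]eq_bigr do rewrite exchange_big/=.
    rewrite exchange_big/=; apply: eq_bigr => c' _.
    rewrite normCK rmorph_sum mulr_sumr; apply: eq_bigr => k _.
    rewrite mulr_suml; apply: eq_bigr => i _.
    by rewrite rmorphM/= -!mulrA; congr (_ * (_ * _)); rewrite mulrC.
  move=> /eqP; rewrite psumr_eq0; last by move=> c' _; rewrite exprn_ge0.
  by move=> /allP/(_ _ tB); rewrite /= expf_eq0/= normr_eq0 => /eqP.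
have [J [pt [P fP]]] := fS.
(* [z] holds the inner products that [x] must have with the [f_k]; [x] is built from the conjugated
   dual functionals of [f], so it has finite support and lies in l2. *)
pose z := invmx G *m (\col_i c i).
pose x b := \sum_k z k ord0 * \sum_j (P k j)^* * (b == pt j)%:R.
exists x.
  apply: (@supported_l2 _ (codom pt)) => b bpt; rewrite /x big1// => k _.
  rewrite big1 ?mulr0// => j _; case: eqP => [E|]; last by rewrite mulr0.
  by move: bpt; rewrite E codom_f.
rewrite rangeE; apply/funext => a; apply: eq_bigr => i _; congr (_ * _).
have fP' k l : \sum_(b <- A) (f k b)^* * (\sum_j (P l j)^* * (b == pt j)%:R) =
    (l == k)%:R.
  transitivity ((l == k)%:R : C)^*; last by rewrite rmorph_nat.
  rewrite -fP rmorph_sum; under eq_bigr do rewrite mulr_sumr.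
  rewrite exchange_big/=; apply: eq_bigr => j _.
  have [ptA|ptA] := boolP (pt j \in A); last first.
    rewrite (fA k (pt j))// mulr0 conjC0 big_seq big1// => b bA.
    case: eqP => [E|]; last by rewrite !mulr0.
    by move: ptA; rewrite -E bA.
  rewrite (bigD1_seq (pt j))//= eqxx mulr1 big1 ?addr0 => [|b /negPf->].
    by rewrite rmorphM/= mulrC.
  by rewrite !mulr0.
have fx k : \sum_(b <- A) (f k b)^* * x b = z k ord0.
  rewrite /x; under eq_bigr do rewrite mulr_sumr.
  rewrite exchange_big/= (bigD1 k)//= [X in _ + X]big1 ?addr0 => [|l lk].
    under eq_bigr do rewrite mulrCA.
    by rewrite -mulr_sumr fP' eqxx mulr1.
  under eq_bigr do rewrite mulrCA.
  by rewrite -mulr_sumr fP' (negPf lk) mulr0.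
clearbody x.
transitivity (\sum_k G i k * z k ord0).
  have := congr1 (fun X : 'cV[C]_r => X i ord0) (mulKVmx Gunit (\col_i c i)).
  by rewrite /z !mxE => <-.
under eq_bigr do rewrite -fx [G _ _]mxE mulr_suml.
rewrite exchange_big/=.
under [RHS]eq_bigr do under eq_bigr do rewrite Mfg rmorph_sum mulr_sumr mulr_suml.
rewrite [RHS]exchange_big/=; apply: eq_bigr => c' _.
under eq_bigr do rewrite mulr_sumr.
rewrite exchange_big/=; apply: eq_bigr => b _; apply: eq_bigr => k _.
by rewrite rmorphM/= !mulrA; congr (_ * _); rewrite -!mulrA; congr (_ * _); rewrite mulrC.
Qed.

End FiniteSums.

(** * Local maps on product states *)

Section LocalMaps.
Local Set Implicit Arguments.
Local Unset Strict Implicit.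
Variable R : realType.
Local Notation C := R[i].

Definition ford (T : finType) (K : nat) (t : {ffun T -> 'I_K}) : {ffun T -> nat} :=
  [ffun j => nat_of_ord (t j)].

Definition boxed (T : finType) (K : nat) (x : {ffun T -> nat} -> C) : Prop :=
  forall a : {ffun T -> nat}, ~~ [forall j, (a j < K)%N] -> x a = 0.

Lemma fordP (T : finType) (K : nat) (a : {ffun T -> nat}) :
  [forall j, (a j < K)%N] -> exists t : {ffun T -> 'I_K}, a = ford t.
Proof.
move=> /forallP aK; exists [ffun j => Ordinal (aK j)].
by apply/ffunP => j; rewrite !ffunE.
Qed.

Lemma ford_inj (T : finType) (K : nat) : injective (@ford T K).
Proof.
by move=> t u /ffunP tu; apply/ffunP => j; apply/val_inj; have := tu j; rewrite !ffunE.
Qed.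

Lemma boxed_supported (T : finType) (K : nat) (x : {ffun T -> nat} -> C) :
  boxed K x -> supported (codom (@ford T K)) x.
Proof.
move=> xK a aK; apply: xK; apply: contra aK => /fordP[t ->].
exact: codom_f.
Qed.

Lemma boxed_sum (T : finType) (K : nat) (x : {ffun T -> nat} -> C) a :
  boxed K x -> \sum_(t : {ffun T -> 'I_K}) x (ford t) * (a == ford t)%:R = x a.
Proof.
move=> xK; have [/fordP[t ->]|aK] := boolP [forall j, (a j < K)%N].
  rewrite (bigD1 t)//= eqxx mulr1 big1 ?addr0// => u ut.
  by rewrite (inj_eq (@ford_inj _ _)) eq_sym (negPf ut) mulr0.
rewrite xK// big1// => t _; case: eqP => [E|]; last by rewrite mulr0.
by case/negP: aK; apply/forallP => j; rewrite E ffunE.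
Qed.

(* The action of the local operators sending |n> on mode j to the vector with
   coefficients w j n, on states with at most K levels per mode. *)
Definition local_map (T : finType) (K : nat) (w : T -> nat -> nat -> C)
    (x : {ffun T -> nat} -> C) : {ffun T -> nat} -> C :=
  fun a => \sum_(t : {ffun T -> 'I_K}) x (ford t) * \prod_j w j (t j) (a j).

Lemma local_map_tensor (T : finType) K w (v : T -> nat -> C) :
  local_map K w (tensor v) =
  tensor (fun j s => \sum_(n < K) v j n * w j n s).
Proof.
apply/funext => a; rewrite /tensor bigA_distr_bigA; apply: eq_bigr => t _.
by rewrite big_split/=; congr (_ * _); apply: eq_bigr => j _; rewrite ffunE.
Qed.

Lemma local_map_sum (T : finType) K w r (f : 'I_r -> {ffun T -> nat} -> C)
    (c : 'I_r -> C) :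
  local_map K w (fun a => \sum_i c i * f i a) =
  (fun a => \sum_i c i * local_map K w (f i) a).
Proof.
apply/funext => a; rewrite /local_map.
under eq_bigr do rewrite mulr_suml.
rewrite exchange_big/=; apply: eq_bigr => i _; rewrite mulr_sumr.
by apply: eq_bigr => t _; rewrite mulrA.
Qed.

Lemma local_mapZ (T : finType) K w (c : C) (x : {ffun T -> nat} -> C) :
  local_map K w (fun a => c * x a) = (fun a => c * local_map K w x a).
Proof.
apply/funext => a; rewrite /local_map mulr_sumr.
by apply: eq_bigr => t _; rewrite mulrA.
Qed.

(** The first clause makes [p] a left inverse of [w] on levels below [K], reading only the first [L]
    coordinates; the second makes the vectors [p s] finitely supported, so that [p] can itself serve
    as a local map. *)
Definition left_dual (K L : nat) (w p : nat -> nat -> C) : Prop :=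
  (forall n n', (n < K)%N -> \sum_(s < L) w n s * p s n' = (n == n')%:R) /\
  (forall s n', (K <= n')%N -> p s n' = 0).

(** Distributivity turns the composite kernel into a product over modes of sums
    [sum_s w n s * p s n'], each a Kronecker delta. *)
Lemma local_mapK (T : finType) K L (w p : T -> nat -> nat -> C) x :
  (forall j, left_dual K L (w j) (p j)) -> boxed K x ->
  local_map L p (local_map K w x) = x.
Proof.
move=> wp xK; apply/funext => a; rewrite -[RHS](boxed_sum a xK) /local_map.
under eq_bigr do rewrite mulr_suml.
rewrite exchange_big/=; apply: eq_bigr => t _.
transitivity (x (ford t) * \prod_j \sum_(s < L) w j (t j) s * p j s (a j)).
  rewrite bigA_distr_bigA mulr_sumr; apply: eq_bigr => s _.
  rewrite -mulrA -big_split/=; congr (_ * _).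
  by apply: eq_bigr => j _; rewrite ffunE.
congr (_ * _); under eq_bigr do rewrite (wp _).1//.
have [->|at_] := eqVneq a (ford t).
  by rewrite big1// => j _; rewrite ffunE eqxx.
have /existsNP[j /eqP aj] : ~ forall j, a j = ford t j.
  by move=> E; case/eqP: at_; apply/ffunP.
by apply/eqP/prodf_eq0; exists j => //; move: aj; rewrite ffunE eq_sym => /negPf->.
Qed.

(** The new dual functionals are the old ones composed with the left inverse [local_map L p]; they
    evaluate only at tuples below [L]. *)
Lemma separated_local_map (T : finType) K L w p r
    (f : 'I_r -> {ffun T -> nat} -> C) :
  (forall j : T, left_dual K L (w j) (p j)) -> (forall i, boxed K (f i)) ->
  separated_family f -> separated_family (fun i => local_map K w (f i)).
Proof.
move=> wp fK [J [pt [P fP]]].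
exists {ffun T -> 'I_L}, (@ford T L),
  (fun i (s : {ffun T -> 'I_L}) => \sum_j P i j * \prod_l p l (s l) (pt j l)) => i k.
rewrite -fP; under eq_bigr do rewrite mulr_suml.
rewrite exchange_big/=; apply: eq_bigr => j _.
rewrite -[in RHS](local_mapK wp (fK k)) mulr_sumr.
by apply: eq_bigr => s _; rewrite -mulrA; congr (_ * _); rewrite mulrC.
Qed.

Lemma lin_span_local_map (T : finType) K w r (f : 'I_r -> {ffun T -> nat} -> C) :
  lin_span (fun i => local_map K w (f i)) = (local_map K w @` lin_span f)%classic.
Proof.
apply/seteqP; split => [y [c ->]|_ [_ [c ->] <-]].
  by exists (fun a => \sum_i c i * f i a); [exists c|rewrite local_map_sum].
by exists c; rewrite local_map_sum.
Qed.

Definition product_rays (T : finType) (V : set ({ffun T -> nat} -> C)) :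
    set (set ({ffun T -> nat} -> C)) :=
  ([set ray x | x in [set x | [/\ V x, is_product x & exists a, x a != 0]]])%classic.

Lemma local_map_ray (T : finType) K w (x : {ffun T -> nat} -> C) :
  (local_map K w @` ray x)%classic = ray (local_map K w x).
Proof.
apply/seteqP; split => [_ [_ [c c0 ->] <-]|_ [c c0 ->]].
  by exists c => //; rewrite local_mapZ.
by exists (fun a => c * x a); [exists c|rewrite local_mapZ].
Qed.

(** The local map and its left inverse both send product vectors to product vectors and, on the
    vectors concerned, preserve being nonzero. Taking images is therefore a bijection between the
    two sets of rays. *)
Lemma card_product_rays (T : finType) K L w p (V : set ({ffun T -> nat} -> C)) :
  (forall j : T, left_dual K L (w j) (p j)) ->
  (forall j (v : nat -> C), l2 (fun s => \sum_(n < K) v n * w j n s)) ->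
  (forall x, V x -> boxed K x) ->
  (product_rays (local_map K w @` V)%classic #= product_rays V)%card.
Proof.
move=> wp wl2 VK.
have -> : (product_rays (local_map K w @` V)
    = (fun X : set ({ffun T -> nat} -> C) => local_map K w @` X)
        @` product_rays V)%classic.
  apply/seteqP; split => [_ [_ [[x Vx <-] yprod ynz]] <-|_ [_ [x [Vx xprod xnz] <-] <-]].
    exists (ray x); last exact: local_map_ray.
    exists x => //; split => //.
      (* The pulled-back factors live on levels below [K], by the second clause of [left_dual],
         hence are in l2. *)
      have [v vl2 yv] := yprod.
      rewrite -(local_mapK wp (VK _ Vx)) yv local_map_tensor.
      eexists; last by []; move=> j.
      apply: (@supported_l2 _ _ (iota 0 K)) => n; rewrite mem_iota/= add0n -leqNgt => Kn.
      by rewrite big1// => s _; rewrite (wp j).2// mulr0.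
    apply: contrapT => /forallNP x0; have [a /eqP] := ynz; apply.
    by rewrite /local_map big1// => t _; have /negP/negPn/eqP-> := x0 (ford t); rewrite mul0r.
  exists (local_map K w x); last by rewrite local_map_ray.
  split; first by exists x.
    have [v vl2 ->] := xprod; rewrite local_map_tensor.
    by eexists; last by []; move=> j; exact: wl2.
  apply: contrapT => /forallNP y0; have [a /eqP] := xnz; apply.
  rewrite -(local_mapK wp (VK _ Vx)) {1}/local_map big1// => t _.
  by have /negP/negPn/eqP-> := y0 (ford t); rewrite mul0r.
apply: inj_card_eq => X Y; rewrite !inE => -[x [Vx _ _] <-] [y [Vy _ _] <-] /=.
move=> /(congr1 (fun X => local_map L p @` X)%classic).
by rewrite !local_map_ray !(local_mapK wp) //; exact: VK.
Qed.

End LocalMaps.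

(** * SLOCC invariants *)

Section LocalEquivalence.
Local Set Implicit Arguments.
Local Unset Strict Implicit.
Variable R : realType.
Local Notation C := R[i].

Lemma ket_l2 n : l2 (ket R n).
Proof.
by apply: (@supported_l2 _ _ [:: n]) => k; rewrite inE /ket => /negPf->.
Qed.

Lemma tensor_ket (T : finType) (t a : {ffun T -> nat}) :
  tensor (fun j => ket R (t j)) a = (a == t)%:R.
Proof.
rewrite /tensor /ket; have [->|at_] := eqVneq a t.
  by rewrite big1// => j _; rewrite eqxx.
have /existsNP[j /eqP aj] : ~ forall j, a j = t j.
  by move=> E; case/eqP: at_; apply/ffunP.
by apply/eqP/prodf_eq0; exists j => //; rewrite (negPf aj).
Qed.

(** * Index tuples across a bipartition *)

Section Merge.
Variables (I : finType) (S : {set I}).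
Implicit Types (a : {ffun {j : I | j \in S} -> nat}).
Implicit Types (b : {ffun {j : I | j \in ~: S} -> nat}).

Lemma merge_modesl a b u : merge_modes a b (val u) = a u.
Proof. by rewrite ffunE valK. Qed.

Lemma merge_modesr a b u : merge_modes a b (val u) = b u.
Proof.
rewrite ffunE valK insubN//.
by have := valP u; rewrite inE.
Qed.

Lemma merge_modes_surj (x : {ffun I -> nat}) : exists a b, x = @merge_modes I S a b.
Proof.
exists [ffun u => x (val u)], [ffun u => x (val u)].
apply/ffunP => j; have [jS|jS] := boolP (j \in S).
  by rewrite -(SubK {j | j \in S} jS) merge_modesl ffunE.
have jS' : j \in ~: S by rewrite inE.
by rewrite -(SubK {j | j \in ~: S} jS') merge_modesr ffunE.
Qed.

Lemma big_merge_modes (M : Type) (idx : M) (op : Monoid.com_law idx)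
    (h : I -> nat -> M) a b :
  \big[op/idx]_(j : I) h j (merge_modes a b j) =
  op (\big[op/idx]_(u : {j : I | j \in S}) h (val u) (a u))
     (\big[op/idx]_(u : {j : I | j \in ~: S}) h (val u) (b u)).
Proof.
rewrite (bigID (mem S))/= (big_sub (mem S) (fun j => h j (merge_modes a b j))).
congr (op _ _); first by apply: eq_bigr => u _; rewrite merge_modesl.
rewrite (eq_bigl (mem (~: S))); last by move=> j; rewrite /= inE.
rewrite (big_sub (mem (~: S)) (fun j => h j (merge_modes a b j))).
by apply: eq_bigr => u _; rewrite merge_modesr.
Qed.

Lemma merge_modes_eq a b a' b' :
  (merge_modes a b == merge_modes a' b') = (a == a') && (b == b').
Proof.
apply/eqP/andP => [/ffunP E|[/eqP-> /eqP->]//]; split; apply/eqP/ffunP => u.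
  by have := E (val u); rewrite !merge_modesl.
by have := E (val u); rewrite !merge_modesr.
Qed.

End Merge.

Lemma bounded_operator_sum (T U : choiceType) (F : (T -> C) -> (U -> C))
    (J : finType) (A : seq T) (c : J -> C) (x : J -> T -> C) :
  bounded_operator F -> (forall j, supported A (x j)) ->
  F (fun t => \sum_j c j * x j t) = (fun u => \sum_j c j * F (x j) u).
Proof.
move=> [_ Flin _] xA.
have l20 : l2 (fun _ : T => 0 : C) by apply: (@supported_l2 _ _ [::]).
have F0 : F (fun=> 0) = fun=> 0.
  (* Linearity is available only in the form [c * x + y]; taking c = -1 and x = y = 0 yields F 0 = -
     F 0 + F 0 = 0. *)
  have := Flin (-1) _ _ l20 l20.
  have -> : (fun _ : T => -1 * 0 + 0 : C) = (fun=> 0).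
    by apply/funext => t; rewrite mulr0 addr0.
  by move=> ->; apply/funext => u; rewrite mulN1r addNr.
elim: (index_enum J) => [|j s IH].
  rewrite [X in F X](_ : _ = fun=> 0); last by apply/funext => t; rewrite big_nil.
  by rewrite F0; apply/funext => u; rewrite big_nil.
rewrite [X in F X](_ : _ = fun t => c j * x j t + \sum_(j <- s) c j * x j t).
  rewrite Flin ?IH; first by apply/funext => u; rewrite big_cons.
    exact: supported_l2 (xA j).
  apply: (@supported_l2 _ _ A) => t tA.
  by rewrite big1// => k _; rewrite xA// mulr0.
by apply/funext => t; rewrite big_cons.
Qed.

(** Every cut-off beyond the last evaluation point works; this uniformity later allows one common
    [L] for all modes. *)
Lemma separated_left_dual (K : nat) (w : nat -> nat -> C) :
  separated_family (fun n : 'I_K => w n) ->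
  exists (L0 : nat) (p : nat -> nat -> C), forall L, (L0 <= L)%N -> left_dual K L w p.
Proof.
move=> [J [pt [P wP]]].
(* The points [pt j] may repeat, so the weights of all [j] with [pt j = s] are added up; the default
   0 supplies the vanishing for [n' >= K]. *)
pose p s n' : C := if insub n' is Some i
  then \sum_j (pt j == s)%:R * P i j else 0.
exists (\max_j (pt j)).+1%N, p => L maxL; split; last first.
  by move=> s n' Kn'; rewrite /p insubN// -leqNgt.
move=> n n' nK; rewrite /p; case: insubP => [i _ <-|]; last first.
  rewrite -leqNgt => Kn'; rewrite big1 => [|s _]; last by rewrite mulr0.
  by case: eqP => // E; rewrite -E leqNgt nK in Kn'.
have := wP i (Ordinal nK); rewrite -val_eqE/= eq_sym => <-.
under eq_bigr do rewrite mulr_sumr.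
rewrite exchange_big/=; apply: eq_bigr => j _.
have ptL : (pt j < L)%N by apply: leq_trans maxL; rewrite ltnS; exact: leq_bigmax.
rewrite (bigD1 (Ordinal ptL))//= eqxx mul1r big1 ?addr0 => [|s /negPf sj].
  by rewrite mulrC.
have -> : (pt j == s) = false by rewrite eq_sym; exact: sj.
by rewrite mul0r mulr0.
Qed.

(** A state with finitely many levels is a finite combination of number states, so the tensor
    operator acts on it through the vectors [w j n = A_j |n>] alone, and this action factors over
    every bipartition. Injectivity of [A_j] makes these vectors independent, which provides the dual
    family [p]. *)
Lemma slocc_local_maps (I : finType) (psi phi : {ffun I -> nat} -> C) (K : nat) :
  slocc psi phi ->
  exists L (w p : I -> nat -> nat -> C),
  [/\ forall j, left_dual K L (w j) (p j),
      forall j (v : nat -> C), l2 (fun s => \sum_(n < K) v n * w j n s) &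
      forall (S : {set I}) r (f : 'I_r -> _) g,
        (forall a b, @coef_matrix R I S psi a b = \sum_i f i a * g i b) ->
        (forall i, boxed K (f i)) -> (forall i, boxed K (g i)) ->
        forall a b, @coef_matrix R I S phi a b =
          \sum_i local_map K (fun j => w (val j)) (f i) a *
                 local_map K (fun j => w (val j)) (g i) b].
Proof.
move=> [A [Ainv [F [Fbd Ften] ->]]].
pose w j n := A j (ket R n).
have ket_sum j (v : nat -> C) : (fun s => \sum_(n < K) v n * w j n s) =
    A j (fun s => \sum_(n < K) v n * ket R n s).
  have [Abd _] := Ainv j.
  rewrite (@bounded_operator_sum _ _ _ _ (iota 0 K) (fun n : 'I_K => v n) _ Abd)// => n k.
  rewrite mem_iota/= add0n -leqNgt /ket => Kk.
  by case: eqP => // E; move: (ltn_ord n); rewrite -E ltnNge Kk.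
have ket_suml2 (v : nat -> C) : l2 (fun s => \sum_(n < K) v n * ket R n s).
  apply: (@supported_l2 _ _ (iota 0 K)) => k.
  rewrite mem_iota/= add0n -leqNgt /ket => Kk; rewrite big1// => n _.
  by case: eqP => [E|]; [move: (ltn_ord n); rewrite -E ltnNge Kk|rewrite mulr0].
have /boolp.choice[Lp Lp_dual] : forall j, exists Lp : nat * (nat -> nat -> C),
    forall L, (Lp.1 <= L)%N -> left_dual K L (w j) Lp.2.
  move=> j; suff /separated_left_dual[L0 [p Lp]] : separated_family (fun n : 'I_K => w j n).
    by exists (L0, p).
  apply: free_separated => c c0 i.
  have [Abd [G [Gbd GA]]] := Ainv j.
  pose v n : C := if insub n is Some i then c i else 0.
  have vc (i' : 'I_K) : v i' = c i' by rewrite /v valK.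
  (* A vanishing combination of the [A_j |n>] is the image of the same combination of kets; applying
     the inverse [G] and reading off coordinate [i] gives [c i = 0]. *)
  have : A j (fun s => \sum_(n < K) v n * ket R n s) = A j (fun=> 0).
    rewrite -ket_sum; transitivity (fun _ : nat => 0 : C).
      by apply/funext => s; rewrite -[RHS](c0 s); apply: eq_bigr => n _; rewrite vc.
    have := @bounded_operator_sum _ _ _ _ [::] (fun _ : 'I_0 => 0) (fun _ _ => 0) Abd.
    have -> : (fun t : nat => \sum_(j < 0) 0 * 0 : C) = fun=> 0.
      by apply/funext => t; rewrite big_ord0.
    by move=> ->//; apply/funext => u; rewrite big_ord0.
  move=> /(congr1 G); rewrite (GA _ _).2// (GA _ _).2; last first.
    by apply: (@supported_l2 _ _ [::]).
  move=> /(congr1 (fun h => h (i : nat))); rewrite (bigD1 i)//= vc /ket eqxx mulr1.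
  rewrite big1 ?addr0// => k ki.
  by rewrite eq_sym (negPf (_ : (k : nat) != i))// mulr0.
exists (\max_j (Lp j).1)%N, w, (fun j => (Lp j).2); split.
- by move=> j; apply: Lp_dual; exact: (@leq_bigmax _ (fun j => (Lp j).1) j).
- move=> j v; rewrite ket_sum; have [[+ _ _] _] := Ainv j; exact.
move=> S r f g psi_fg fK gK a b.
pose J := ('I_r * ({ffun {j : I | j \in S} -> 'I_K} *
                   {ffun {j : I | j \in ~: S} -> 'I_K}))%type.
pose e (j : J) := merge_modes (ford j.2.1) (ford j.2.2).
pose c (j : J) : C := f j.1 (ford j.2.1) * g j.1 (ford j.2.2).
have sumJ (al : {ffun {j : I | j \in S} -> nat} -> C) be :
    \sum_(j : J) c j * (al (ford j.2.1) * be (ford j.2.2)) =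
    \sum_i (\sum_(s : {ffun _ -> 'I_K}) f i (ford s) * al (ford s)) *
           (\sum_(u : {ffun _ -> 'I_K}) g i (ford u) * be (ford u)).
  rewrite -(pair_bigA _ (fun i su => f i (ford su.1) * g i (ford su.2) *
     (al (ford su.1) * be (ford su.2))))/=.
  apply: eq_bigr => i _; rewrite big_distrlr/= pair_bigA/=.
  by apply: eq_bigr => su _; rewrite mulrACA.
have psiE : psi = fun x => \sum_j c j * tensor (fun k => ket R (e j k)) x.
  apply/funext => x; have [a' [b' ->]] := merge_modes_surj S x.
  rewrite -/(coef_matrix psi a' b') psi_fg.
  transitivity (\sum_(j : J) c j * ((a' == ford j.2.1)%:R * (b' == ford j.2.2)%:R)).
    rewrite (sumJ (fun s => (a' == s)%:R) (fun u => (b' == u)%:R)).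
    by apply: eq_bigr => i _; rewrite !boxed_sum.
  by apply: eq_bigr => j _; rewrite tensor_ket merge_modes_eq -mulnb natrM.
rewrite /coef_matrix psiE (@bounded_operator_sum _ _ _ _ (codom e))//; last first.
  move=> j x; rewrite tensor_ket; case: eqP => // -> /negP; case.
  exact: codom_f.
rewrite /local_map.
transitivity (\sum_(j : J) c j *
   ((\prod_u w (val u) (ford j.2.1 u) (a u)) *
    (\prod_u w (val u) (ford j.2.2 u) (b u)))).
  apply: eq_bigr => j _; congr (_ * _).
  rewrite Ften; last by move=> k; exact: ket_l2.
  rewrite /tensor -/w (big_merge_modes _ (fun k s => A k (ket R (e j k)) s)).
  congr (_ * _); apply: eq_bigr => u _.
    by rewrite /e merge_modesl.
  by rewrite /e merge_modesr.
rewrite (sumJ (fun s => \prod_u w (val u) (s u) (a u))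
              (fun s => \prod_u w (val u) (s u) (b u))).
apply: eq_bigr => i _; congr (_ * _); apply: eq_bigr => s _; congr (_ * _);
  by apply: eq_bigr => u _; rewrite ffunE.
Qed.

Definition boxed_decomposes (I : finType) (S : {set I})
    (psi : {ffun I -> nat} -> C) (K r : nat) f g : Prop :=
  [/\ decomposes (@coef_matrix R I S psi) f g,
      forall i : 'I_r, boxed K (f i) & forall i, boxed K (g i)].

Lemma product_states_rays (I : finType) (S : {set I}) psi K r f g :
  @boxed_decomposes I S psi K r f g ->
  @product_states R I S psi = product_rays (lin_span f).
Proof.
move=> [D fK gK]; rewrite /product_states /product_rays.
rewrite (@reduced_range_span _ _ _ _ _ _ _
  (codom (@ford _ K)) (codom (@ford _ K)) D)// => i; exact: boxed_supported.
Qed.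

(** The image of the decomposition of [psi] decomposes [phi], so it has the length and the span of
    the given one. The images need not have finite support, so the range for [phi] is computed from
    [f'] and only then identified with the span of the images. *)
Lemma slocc_invariants (I : finType) (S : {set I}) psi phi K K' r r' f g f' g' :
  slocc psi phi ->
  @boxed_decomposes I S psi K r f g -> @boxed_decomposes I S phi K' r' f' g' ->
  r = r' /\ (@product_states R I S phi #= @product_states R I S psi)%card.
Proof.
move=> /(@slocc_local_maps _ _ _ K)[L [w [p [wp wl2 phiE]]]] D D'.
rewrite (product_states_rays D) (product_states_rays D').
case: D D' => -[psi_fg fS gS] fK gK [D' _ _].
have D : decomposes (@coef_matrix R I S phi)
    (fun i => local_map K (fun j => w (val j)) (f i))
    (fun i => local_map K (fun j => w (val j)) (g i)).
  split; first exact: phiE.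
    by apply: (@separated_local_map _ _ _ L _ (fun j => p (val j))).
  by apply: (@separated_local_map _ _ _ L _ (fun j => p (val j))).
split; first by apply/eqP; rewrite eqn_leq (decomposes_leq D D') (decomposes_leq D' D).
rewrite -(decomposes_eq_span D D') lin_span_local_map.
apply: (@card_product_rays _ _ _ L _ (fun j => p (val j))) => //.
by move=> _ [c ->] a aK; rewrite big1// => i _; rewrite fK// mulr0.
Qed.

End LocalEquivalence.

(** * Schmidt decomposition of the representatives *)

Section Representatives.
Local Set Implicit Arguments.
Local Unset Strict Implicit.
Variable R : realType.
Local Notation C := R[i].

(** The column of [M] at [pt i] is the nonzero multiple [w i] of [f i], so these columns form a
    basis of the column space. *)
Lemma has_rank_diag (T U : Type) (M : T -> U -> C) (r : nat) f g
    (pt : 'I_r -> U) (w : 'I_r -> C) :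
  decomposes M f g -> (forall i, w i != 0) ->
  (forall i k, g k (pt i) = (i == k)%:R * w i) -> has_rank M r.
Proof.
move=> [Mfg fS _] w0 gw.
have Mpt t i : M t (pt i) = w i * f i t.
  rewrite Mfg (bigD1 i)//= gw eqxx mul1r big1 ?addr0 => [|k ki].
    by rewrite mulrC.
  by rewrite gw eq_sym (negPf ki) mul0r mulr0.
exists pt; split => [c c0 i|u].
  suff : c i * w i = 0 by move/eqP; rewrite mulf_eq0 (negPf (w0 i)) orbF => /eqP.
  move: i; apply: (separated_free fS) => t; rewrite -[RHS](c0 t).
  by apply: eq_bigr => k _; rewrite Mpt mulrA.
exists (fun i => g i u / w i) => t; rewrite Mfg; apply: eq_bigr => i _.
by rewrite Mpt mulrA divfK// mulrC.
Qed.

Definition weight (T : finType) (h : nat -> C) (a : {ffun T -> nat}) : C :=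
  \prod_j h (a j).

(* The basis states occurring in the i-th Schmidt vector of
   |Phi_N> + sum_(n > N) |n ... n>. *)
Definition level (T : finType) (N i : nat) (a : {ffun T -> nat}) : bool :=
  if (i <= N)%N then (\sum_j a j)%N == i else [forall j, a j == i].

(** The level facing level [i] across a bipartition: i photons out of N leave N - i, while |n ... n>
    shows n on both sides. *)
Definition partner (N i : nat) : nat := if (i <= N)%N then (N - i)%N else i.

Definition core (T : finType) (N r : nat) (a : {ffun T -> nat}) : C :=
  ((\sum_j a j)%N == N)%:R + \sum_(N.+1 <= n < (N + r).+1) [forall j, a j == n]%:R.

Definition is_core (T : finType) (psi : {ffun T -> nat} -> C) (N r : nat) : Prop :=
  exists (kappa : C) (h : nat -> C),
    [/\ kappa != 0, forall n, h n != 0 &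
        forall a, psi a = kappa * (weight h a * core N r a)].

Lemma weight_neq0 (T : finType) h (a : {ffun T -> nat}) :
  (forall n, h n != 0) -> weight h a != 0.
Proof. by move=> h0; apply/prodf_neq0 => j _. Qed.

Lemma partnerK N : involutive (partner N).
Proof.
rewrite /partner => i; case: (leqP i N) => [iN|Ni]; last by rewrite leqNgt Ni.
by rewrite leq_subr subKn.
Qed.

Lemma partner_lt N r i : (i < (N + r).+1)%N -> (partner N i < (N + r).+1)%N.
Proof.
by rewrite /partner; case: (leqP i N) => // _ _; lia.
Qed.

(** A tuple belonging to level [i] and to no other: all i photons in mode [j0] when i <= N, and |i
    ... i> otherwise. Sampling there makes the Schmidt vectors diagonal. *)
Definition level_point (T : finType) (N : nat) (j0 : T) (i : nat) : {ffun T -> nat} :=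
  [ffun j => if (i <= N)%N && (j != j0) then 0%N else i].

Lemma level_level_point (T : finType) N (j0 : T) i k :
  level N k (level_point N j0 i) = (i == k).
Proof.
rewrite /level /level_point; have [iN|Ni] := leqP i N.
  have sumE : (\sum_j [ffun j => if j != j0 then 0 else i] j)%N = i.
    rewrite (bigD1 j0)//= ffunE eqxx/= big1 ?addn0// => j jj0.
    by rewrite ffunE jj0.
  rewrite [X in (X == k)](_ : _ = i); last first.
    by rewrite -[RHS]sumE; apply: eq_bigr => j _; rewrite !ffunE.
  case: leqP => // Nk; apply/idP/idP => [/forallP/(_ j0)|/eqP E].
    by rewrite ffunE eqxx.
  by rewrite E leqNgt Nk in iN.
case: leqP => [kN|Nk].
  have ik : (k < i)%N by exact: leq_ltn_trans Ni.
  rewrite (gtn_eqF ik); apply/negbTE; rewrite neq_ltn; apply/orP; right.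
  by rewrite (bigD1 j0)//= ffunE (leq_trans ik)// leq_addr.
apply/forallP/eqP => [/(_ j0)|-> j]; rewrite ffunE//=.
by move/eqP.
Qed.

Lemma level_boxed (T : finType) (N i : nat) (a : {ffun T -> nat}) u :
  level N i a -> (a u <= i)%N.
Proof.
rewrite /level; case: leqP => _ => [/eqP<-|/forallP/(_ u)/eqP->//].
by rewrite (bigD1 u)//= leq_addr.
Qed.

Lemma core_merge_modes (I : finType) (S : {set I}) N r a b :
  core N r (@merge_modes I S a b) =
  \sum_(i < (N + r).+1) (level N i a)%:R * (level N (partner N i) b)%:R.
Proof.
rewrite /core (big_merge_modes _ (fun _ n => n))/=.
set sa := (\sum_u a u)%N; set sb := (\sum_u b u)%N.
rewrite -(big_mkord xpredT (fun i => (level N i a)%:R * (level N (partner N i) b)%:R)).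
(* Indices up to [N] split the total photon number between the two sides; those above [N] match the
   terms |n ... n> one by one. *)
rewrite [RHS](@big_cat_nat _ _ _ N.+1)//= ?ltnS ?leq_addr//; congr (_ + _); last first.
  apply: eq_big_nat => n /andP[Nn _]; rewrite -natrM mulnb; congr (_%:R).
  rewrite /level /partner leqNgt Nn/= leqNgt Nn/=; congr nat_of_bool.
  apply/forallP/andP => [E|[/forallP aE /forallP bE] j]; first split; first 2 last.
  - have [jS|jS] := boolP (j \in S).
      by rewrite -(SubK {j | j \in S} jS) merge_modesl.
    have jS' : j \in ~: S by rewrite inE.
    by rewrite -(SubK {j | j \in ~: S} jS') merge_modesr.
  - by apply/forallP => u; have := E (val u); rewrite merge_modesl.
  - by apply/forallP => u; have := E (val u); rewrite merge_modesr.
transitivity (\sum_(0 <= i < N.+1) ((sa == i) && (sb == N - i)%N)%:R : C); last first.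
  apply: eq_big_nat => i /=; rewrite ltnS => iN.
  by rewrite -natrM mulnb /level /partner iN leq_subr.
(* Only [i = sa] can contribute, and it occurs exactly when [sa <= N]. *)
rewrite big_mkord; have [saN|Nsa] := leqP sa N.
  rewrite (bigD1 (Ordinal (saN : (sa < N.+1)%N)))//= eqxx big1 ?addr0 => [|i ia].
    by congr ((nat_of_bool _)%:R); lia.
  by case: eqP => //= E; case/eqP: ia; apply/val_inj.
rewrite big1 => [|i _]; first by case: eqP => //; lia.
by case: eqP => //= E; move: (ltn_ord i); lia.
Qed.

(** The weight is multiplicative across the bipartition, so it distributes over the two factors of
    each term of the core. Both parts being nonempty provides the modes [j0] and [j1] at which the
    sample points are based. *)
Lemma core_decomposes (I : finType) (S : {set I}) psi N r kappa h :
  S != finset.set0 -> S != finset.setT ->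
  kappa != 0 -> (forall n, h n != 0) ->
  (forall a, psi a = kappa * (weight h a * core N r a)) ->
  let f (i : 'I_(N + r).+1) a := weight h a * (level N i a)%:R in
  let g (i : 'I_(N + r).+1) b :=
    kappa * (weight h b * (level N (partner N i) b)%:R) in
  @boxed_decomposes R I S psi (N + r).+1 (N + r).+1 f g /\
  has_rank (@coef_matrix R I S psi) (N + r).+1.
Proof.
move=> /set0Pn[k kS] ST k0 h0 psiE f g.
have [l lS] : exists l, l \in ~: S.
  by apply/set0Pn; apply: contra ST => /eqP SC; rewrite -[S]finset.setCK SC finset.setC0.
pose j0 : {j | j \in S} := Sub k kS; pose j1 : {j | j \in ~: S} := Sub l lS.
have fpt i k' : f k' (level_point N j0 i) = (i == k' :> nat)%:R * weight h (level_point N j0 i).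
  by rewrite /f level_level_point mulrC.
have gpt i k' : g k' (level_point N j1 (partner N i)) =
    (i == k' :> nat)%:R * (kappa * weight h (level_point N j1 (partner N i))).
  by rewrite /g level_level_point (inj_eq (can_inj (@partnerK N))) mulrA mulrC.
have D : decomposes (@coef_matrix R I S psi) f g.
  split.
  - move=> a b; rewrite /coef_matrix psiE core_merge_modes.
    rewrite /weight (big_merge_modes _ (fun _ n => h n))/= -/(weight h a) -/(weight h b).
    rewrite !mulr_sumr; apply: eq_bigr => i _.
    by rewrite /f /g; ring.
  - apply: (@separated_diag _ _ _ _ (fun i => level_point N j0 i)
      (fun i => weight h (level_point N j0 i))) => [i|i k'].
      exact: weight_neq0.
    exact: fpt.
  apply: (@separated_diag _ _ _ _ (fun i => level_point N j1 (partner N i))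
    (fun i => kappa * weight h (level_point N j1 (partner N i)))) => [i|i k'].
    by rewrite mulf_neq0// weight_neq0.
  exact: gpt.
split; last first.
  apply: (has_rank_diag (pt := fun i => level_point N j1 (partner N i))
    (w := fun i => kappa * weight h (level_point N j1 (partner N i))) D) => [i|i k'].
    by rewrite mulf_neq0// weight_neq0.
  exact: gpt.
have lvlK (T : finType) n (a : {ffun T -> nat}) : (n < (N + r).+1)%N ->
    ~~ [forall j, (a j < (N + r).+1)%N] -> level N n a = false.
  move=> nN /negP aN; apply/negP => an; apply: aN; apply/forallP => u.
  exact: leq_ltn_trans (level_boxed u an) _.
split => // i a aN.
  by rewrite /f lvlK// mulr0.
by rewrite /g lvlK ?mulr0// partner_lt.
Qed.

End Representatives.

(** * Counting product states *)

Section Classes.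
Local Set Implicit Arguments.
Local Unset Strict Implicit.
Variable R : realType.
Local Notation C := R[i].

Definition ket_diag (T : finType) (n : nat) (a : {ffun T -> nat}) : C :=
  [forall j, a j == n]%:R.

Lemma ket_diagE (T : finType) n (a : {ffun T -> nat}) :
  ket_diag n a = tensor (fun=> ket R n) a.
Proof.
transitivity (tensor (fun j => ket R ([ffun _ : T => n] j)) a); last first.
  by apply: eq_bigr => j _; rewrite ffunE.
rewrite tensor_ket /ket_diag; congr ((nat_of_bool _)%:R).
apply/forallP/eqP => [E|-> j]; last by rewrite ffunE.
by apply/ffunP => j; rewrite ffunE; apply/eqP.
Qed.

(** Enumerates the levels 0, N+1, ..., N+r, those whose Schmidt vector is a product. *)
Definition core_level (N i : nat) : nat := if i == 0%N then 0%N else (N + i)%N.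

(** If a level above [N] occurs, the rectangle cannot leave its diagonal tuple; otherwise the
    highest occurring level must be 0. Both cases use a second mode: on a single mode every vector
    is a product. *)
Lemma core_product (T : finType) N r (h : nat -> C) (c : 'I_(N + r).+1 -> C)
    (v : T -> nat -> C) :
  (1 < #|T|)%N -> (forall n, h n != 0) ->
  (fun a : {ffun T -> nat} =>
     \sum_i c i * (weight h a * (level N i a)%:R)) = tensor v ->
  (exists a, tensor v a != 0) ->
  exists2 i, (i < r.+1)%N &
    tensor v = (fun a => tensor v [ffun=> core_level N i] * ket_diag (core_level N i) a).
Proof.
move=> /card_gt1P[j1 [j2 [_ _ j12]]] h0 yv [a0 a0v].
have yE a : tensor v a = weight h a * \sum_i c i * (level N i a)%:R.
  rewrite -yv mulr_sumr; apply: eq_bigr => i _.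
  by rewrite mulrCA.
have v0 a : tensor v a != 0 -> forall j, v j (a j) != 0.
  by move=> /prodf_neq0 H j; exact: H.
have y_point j0 (i : 'I_(N + r).+1) : c i != 0 -> tensor v (level_point N j0 i) != 0.
  move=> ci; rewrite yE mulf_neq0 ?weight_neq0// (bigD1 i)//=.
  rewrite level_level_point eqxx mulr1 big1 ?addr0// => k ki.
  by rewrite level_level_point eq_sym (negPf (_ : (k : nat) != i)) ?mulr0.
have level_neq0 a : tensor v a != 0 -> exists2 i : 'I__, c i != 0 & level N i a.
  rewrite yE => ya; apply: contrapT => H; case/eqP: ya.
  rewrite big1 ?mulr0// => i _; apply/eqP; rewrite mulf_eq0.
  apply/negPn/negP; rewrite negb_or pnatr_eq0 eqb0 negbK => /andP[ci li].
  by apply: H; exists i.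
have [[i ci Ni]|cN] := pselect (exists2 i, c i != 0 & (N < i)%N).
  have i0 : (i : nat) != 0%N by rewrite -lt0n (leq_ltn_trans _ Ni).
  exists (i - N)%N; first by have := ltn_ord i; lia.
  have -> : core_level N (i - N) = i by rewrite /core_level; case: eqP; lia.
  apply/funext => a; rewrite /ket_diag.
  case: forallP => [E|aE].
    by rewrite mulr1; congr tensor; apply/ffunP => j; rewrite ffunE; apply/eqP.
  rewrite mulr0; apply/eqP/negPn/negP => ya.
  have /existsNP[j /negP aj] := aE.
  have vi l : v l i != 0.
    have := v0 _ (y_point j1 i ci) l.
    by rewrite ffunE leqNgt Ni.
  (* b replaces the j-th entry of |i ... i> by that of a; it lies in the
     rectangular support of the product vector, but in no level. *)
  pose b : {ffun T -> nat} := [ffun l => if l == j then a j else i].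
  have yb : tensor v b != 0.
    apply/prodf_neq0 => l _; rewrite ffunE; case: (l =P j) => [->|_] //.
    exact: v0.
  have [k _] := level_neq0 _ yb.
  have [l lj] : exists l, l != j.
    by have [E|] := eqVneq j1 j; [exists j2; rewrite -E eq_sym|exists j1].
  rewrite /level; case: leqP => [kN /eqP sb|_ /forallP bk].
    move: Ni; rewrite ltnNge (leq_trans _ kN)// -sb (bigD1 l)//= ffunE (negPf lj).
    exact: leq_addr.
  have := bk j; have := bk l; rewrite !ffunE eqxx (negPf lj) => /eqP ik /eqP ajk.
  by rewrite ajk -ik eqxx in aj.
have [i1 ci1 _] := level_neq0 _ a0v.
have [i ci imax] := @arg_maxnP _ i1 (fun i => c i != 0) val ci1.
have iN : (i <= N)%N by rewrite leqNgt; apply/negP => Ni; apply: cN; exists i.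
have i0 : i = 0%N :> nat.
  apply/eqP; rewrite -leqn0 leqNgt; apply/negP => i_gt0.
  have y1 := v0 _ (y_point j1 i ci); have y2 := v0 _ (y_point j2 i ci).
  (* Rectangularity combines the points with i photons in [j1] and with i photons in [j2] into one
     with 2i photons, above the highest level when i > 0. *)
  pose b : {ffun T -> nat} :=
    [ffun l => if (l == j1) || (l == j2) then i : nat else 0%N].
  have yb : tensor v b != 0.
    apply/prodf_neq0 => l _; rewrite ffunE.
    have [->|lj1] := eqVneq l j1; first by have := y1 j1; rewrite ffunE eqxx andbF.
    have [->|lj2] /= := eqVneq l j2; first by have := y2 j2; rewrite ffunE eqxx andbF.
    by have := y1 l; rewrite ffunE iN lj1.
  have [k ck] := level_neq0 _ yb.
  have ki : (k <= i)%N := imax k ck.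
  rewrite /level (leq_trans ki iN) => /eqP sb.
  move: ki; rewrite -sb (bigD1 j1)//= (bigD1 j2)/=; last by rewrite eq_sym.
  by rewrite !ffunE !eqxx orbT/=; lia.
exists 0%N => //; rewrite /core_level eqxx.
apply/funext => a; rewrite /ket_diag.
case: forallP => [E|aE].
  by rewrite mulr1; congr tensor; apply/ffunP => j; rewrite ffunE; apply/eqP.
rewrite mulr0; apply/eqP/negPn/negP => ya; apply: aE => j.
have [k ck kl] := level_neq0 _ ya.
rewrite -leqn0 (leq_trans (level_boxed j kl))// -i0.
exact: imax.
Qed.

Lemma product_rays_core (T : finType) N r (h : nat -> C) :
  (1 < #|T|)%N -> (forall n, h n != 0) ->
  (product_rays (lin_span (fun (i : 'I_(N + r).+1) (a : {ffun T -> nat}) =>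
     weight h a * (level N i a)%:R : C)) #= `I_r.+1)%card.
Proof.
move=> T1 h0; set V := lin_span _.
have /card_gt1P[j0 _] := T1.
have kd1 n : ket_diag n [ffun _ : T => n] = 1.
  by rewrite /ket_diag; case: forallP => // -[] j; rewrite ffunE.
have -> : (product_rays V = (fun i => ray (ket_diag (T := T) (core_level N i))) @` `I_r.+1)%classic.
  apply/seteqP; split => [_ [y [[c yc] [v _ yv] ynz] <-]|_ [i ir <-]].
    have cv := etrans (esym yc) yv.
    have vnz : exists a, tensor v a != 0 by rewrite -yv.
    have [i ir yE] := core_product T1 h0 cv vnz.
    exists i => //; set d := tensor v _ in yE.
    have d0 : d != 0.
      apply/eqP => d0; have [a] := ynz.
      by rewrite yv yE d0 mul0r eqxx.
    apply/seteqP; split => [_ [e e0 ->]|_ [e e0 ->]].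
      exists (e / d); first by rewrite mulf_neq0// invr_eq0.
      by rewrite yv yE; apply/funext => a; rewrite mulrA divfK.
    exists (e * d); first by rewrite mulf_neq0.
    by rewrite yv yE; apply/funext => a; rewrite mulrA.
  exists (ket_diag (core_level N i)) => //; split.
  - have iK : (core_level N i < (N + r).+1)%N.
      by move: ir; rewrite /= /core_level; case: eqP => //; lia.
    (* This level consists of a single tuple, so one coefficient undoes the weight. *)
    exists (fun k => if k == Ordinal iK then (weight h [ffun _ : T => core_level N i])^-1 else 0).
    apply/funext => a; rewrite (bigD1 (Ordinal iK))//= eqxx big1 ?addr0; last first.
      by move=> k /negPf->; rewrite mul0r.
    have -> : level N (core_level N i) a = [forall j, a j == core_level N i].
      rewrite /level /core_level; case: eqP => [_|i0].
        by rewrite leq0n sum_nat_eq0.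
      by rewrite leqNgt; have -> : (N < N + i)%N by lia.
    rewrite /ket_diag; case: forallP => [E|_]; last by rewrite !mulr0.
    rewrite (_ : a = [ffun=> core_level N i]) ?mulr1 ?mulVf ?weight_neq0//.
    by apply/ffunP => j; rewrite ffunE; apply/eqP.
  - exists (fun=> ket R (core_level N i)); first by move=> j; exact: ket_l2.
    by apply/funext => a; rewrite ket_diagE.
  - by exists [ffun=> core_level N i]; rewrite kd1 oner_neq0.
apply: inj_card_eq => i i' _ _ rayE.
have : ray (ket_diag (T := T) (core_level N i)) (ket_diag (core_level N i)).
  by exists 1; [exact: oner_neq0|apply/funext => a; rewrite mul1r].
rewrite rayE => -[c _ /(congr1 (fun x => x [ffun _ : T => core_level N i]))].
rewrite kd1 /ket_diag; case: forallP => [/(_ j0)|_ /eqP]; last first.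
  by rewrite mulr0 oner_eq0.
rewrite ffunE /core_level => /eqP E _; move: E.
by case: (i =P 0%N) => ?; case: (i' =P 0%N) => ?; lia.
Qed.

(** With at least three modes, two or more remain after tracing one out, as the count of product
    rays requires. *)
Lemma core_in_class (I : finType) (psi : {ffun I -> nat} -> C) N r :
  (2 < #|I|)%N -> is_core psi N r -> in_class psi (fun=> r.+1).
Proof.
move=> I2 [kappa [h [k0 h0 psiE]]] k.
have cS : #|~: [set k]%SET| = #|I|.-1 by rewrite cardsC1.
have [||D _] := @core_decomposes R I (~: [set k])%SET psi N r kappa h _ _ k0 h0 psiE.
- by rewrite -card_gt0 cS; lia.
- by apply/eqP => /finset.setP/(_ k); rewrite !inE eqxx.
rewrite (product_states_rays D); apply: product_rays_core => //.
by rewrite card_sig cS; lia.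
Qed.

Lemma core_schmidt_rank (I : finType) (psi : {ffun I -> nat} -> C) N r :
  is_core psi N r -> has_schmidt_rank psi (N + r).+1.
Proof.
move=> [kappa [h [k0 h0 psiE]]] S S0 ST.
by have [] := core_decomposes S0 ST k0 h0 psiE.
Qed.

(** For the bipartition isolating one mode, the rank determines N + r and the number of product
    states determines r. *)
Lemma slocc_core_inj (I : finType) (psi phi : {ffun I -> nat} -> C) N r N' r' :
  (2 < #|I|)%N -> is_core psi N r -> is_core phi N' r' -> slocc psi phi ->
  N = N' /\ r = r'.
Proof.
move=> I2 psi_core phi_core psi_phi.
have /card_gt0P[k _] : (0 < #|I|)%N by exact: leq_trans I2.
have cS : #|~: [set k]%SET| = #|I|.-1 by rewrite cardsC1.
have S0 : (~: [set k])%SET != finset.set0 by rewrite -card_gt0 cS; lia.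
have ST : (~: [set k])%SET != finset.setT.
  by apply/eqP => /finset.setP/(_ k); rewrite !inE eqxx.
have /(_ k)/card_esym := core_in_class I2 psi_core.
have /(_ k) := core_in_class I2 phi_core.
move: psi_core phi_core => [ka [h [ka0 h0 psiE]]] [ka' [h' [ka0' h0' phiE]]].
have [D _] := core_decomposes S0 ST ka0 h0 psiE.
have [D' _] := core_decomposes S0 ST ka0' h0' phiE.
have [rE /card_esym cE] := slocc_invariants psi_phi D D'.
move=> cphi cpsi.
have : (`I_r.+1 #= `I_r'.+1)%card by exact: card_eq_trans (card_eq_trans cpsi cE) cphi.
by move/card_eq_II; lia.
Qed.

End Classes.

(** * Diagonal local operators *)

Section DiagonalOperators.
Local Set Implicit Arguments.
Local Unset Strict Implicit.
Variable R : realType.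
Local Notation C := R[i].

Definition sqmod (z : C) : R := complex.Re z ^+ 2 + complex.Im z ^+ 2.

Lemma sqmod_ge0 z : 0 <= sqmod z.
Proof. by rewrite addr_ge0 ?sqr_ge0. Qed.

Lemma sqmodM z z' : sqmod (z * z') = sqmod z * sqmod z'.
Proof. by case: z z' => [a b] [c d]; rewrite /sqmod /=; ring. Qed.

Lemma sqmod_prod (J : finType) (F : J -> C) :
  sqmod (\prod_j F j) = \prod_j sqmod (F j).
Proof.
apply: (big_morph _ sqmodM).
by rewrite /sqmod /= expr1n expr0n addr0.
Qed.

Lemma bounded_diag (T : choiceType) (D : T -> C) (M : R) :
  (forall t, sqmod (D t) <= M) -> bounded_operator (fun (x : T -> C) t => D t * x t).
Proof.
move=> DM.
(* The maximum with 0 keeps the constant nonnegative even for empty [T]; the bound is checked on the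
   finite partial sums. *)
have bound (x : T -> C) : (sqnorm (fun t => D t * x t)%R <= (Num.max 0 M)%:E * sqnorm x)%E.
  apply: ge_ereal_sup => _ [F [finF _] <-].
  apply: (@le_trans _ _ ((Num.max 0 M)%:E * \sum_(t \in F) (sqmod (x t))%:E)%E).
    rewrite ge0_mule_fsumr; last by move=> t; rewrite lee_fin sqmod_ge0.
    apply: lee_fsum => // t _; rewrite -EFinM lee_fin -/(sqmod _) sqmodM.
    by rewrite ler_wpM2r ?sqmod_ge0// le_max DM orbT.
  apply: lee_wpmul2l; first by rewrite lee_fin le_max lexx.
  by apply: ereal_sup_ubound; exists F.
split; last by exists (Num.max 0 M) => x _; exact: bound.
- move=> x xl2; apply: le_lt_trans (bound x) _.
  by apply: lte_mul_pinfty => //; rewrite lee_fin le_max lexx.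
by move=> c x y _ _; apply/funext => t; ring.
Qed.

(** Being 1 from [K] on keeps both [d j] and its inverse bounded, and the product over modes is
    bounded by the product of the bounds. *)
Lemma slocc_diag (I : finType) (K : nat) (d : I -> nat -> C)
    (psi : {ffun I -> nat} -> C) :
  (forall j n, d j n != 0) -> (forall j n, (K <= n)%N -> d j n = 1) ->
  slocc psi (fun a => (\prod_j d j (a j)) * psi a).
Proof.
move=> d0 dK.
have bound (e : nat -> C) : (forall n, (K <= n)%N -> e n = 1) ->
    forall n, sqmod (e n) <= 1 + \sum_(k < K) sqmod (e k).
  move=> eK n; have [Kn|nK] := leqP K n.
    by rewrite eK// /sqmod /= expr1n expr0n addr0 lerDl sumr_ge0// => k _; exact: sqmod_ge0.
  rewrite (bigD1 (Ordinal nK))//= addrCA lerDl addr_ge0// sumr_ge0// => k _.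
  exact: sqmod_ge0.
exists (fun j x n => d j n * x n); split.
  move=> j; split; first exact: bounded_diag (bound _ (dK j)).
  exists (fun x n => (d j n)^-1 * x n); split.
    apply: bounded_diag; apply: bound => n Kn.
    by rewrite dK// invr1.
  by move=> x _; split; apply/funext => n; rewrite mulrA ?mulVf ?mulfV ?mul1r.
exists (fun (x : {ffun I -> nat} -> C) (a : {ffun I -> nat}) => (\prod_j d j (a j)) * x a) => //; split.
  apply: (@bounded_diag _ _ (\prod_j (1 + \sum_(k < K) sqmod (d j k)))) => a.
  rewrite sqmod_prod; apply: ler_prod => j _.
  by rewrite sqmod_ge0 bound//; exact: dK.
by move=> v _; apply/funext => a; rewrite /tensor big_split.
Qed.

Lemma core_boxed (T : finType) N r : boxed (N + r).+1 (@core R T N r).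
Proof.
move=> a /negP aK; rewrite /core.
have [sa|_] := eqVneq (\sum_j a j)%N N.
  case: aK; apply/forallP => j.
  by rewrite ltnS (leq_trans _ (leq_addr _ _))// -[X in (_ <= X)%N]sa (bigD1 j)//= leq_addr.
rewrite add0r big_nat big1// => n /andP[_ nN].
by case: forallP => // an; case: aK; apply/forallP => j; rewrite (eqP (an j)).
Qed.

Lemma slocc_core (I : finType) (psi phi : {ffun I -> nat} -> C) N r :
  (0 < #|I|)%N -> is_core psi N r -> is_core phi N r -> slocc psi phi.
Proof.
move=> /card_gt0P[j0 _] [ka [h [ka0 h0 psiE]]] [ka' [h' [ka0' h0' phiE]]].
pose K := (N + r).+1.
(* Each mode replaces the weight [h] by [h'], and mode [j0] alone carries the global scalar. The
   ratio [h' / h] may be unbounded, as with square roots of factorials, so it is cut off at [K],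
   beyond which the core vanishes. *)
pose d j n : C := (if (n < K)%N then
  (if j == j0 then ka' / ka else 1) * (h' n / h n) else 1).
have -> : phi = fun a => (\prod_j d j (a j)) * psi a.
  apply/funext => a; rewrite phiE psiE.
  have [aK|aK] := boolP [forall j, (a j < K)%N]; last first.
    by rewrite (core_boxed aK) !mulr0.
  rewrite (eq_bigr (fun j => (if j == j0 then ka' / ka else 1) * (h' (a j) / h (a j)))).
    rewrite big_split/= prodf_div -/(weight h' a) -/(weight h a).
    rewrite (bigD1 j0)//= eqxx big1 ?mulr1 => [|j /negPf->//].
    by field; rewrite ka0 weight_neq0.
  by move=> j _; rewrite /d (forallP aK).
apply: (@slocc_diag I K).
  move=> j n; rewrite /d; case: ifP => _; last exact: oner_neq0.
  by case: ifP => _; rewrite !mulf_neq0 ?invr_eq0 ?oner_neq0.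
by move=> j n Kn; rewrite /d ltnNge Kn.
Qed.

(** * The concrete representatives as weighted cores *)

Lemma fockE m (n : 'I_m -> nat) a : fock R n a = (a == [ffun j => n j])%:R.
Proof.
rewrite -tensor_ket /fock; congr (tensor _ a).
by apply/funext => j; rewrite ffunE.
Qed.

Lemma sum_fock m N (g : {ffun 'I_m -> nat} -> C) a :
  \sum_(t : {ffun 'I_m -> 'I_N.+1} | (\sum_j t j)%N == N) g (ford t) * fock R (fun j => t j) a =
  ((\sum_j a j)%N == N)%:R * g a.
Proof.
pose x (b : {ffun 'I_m -> nat}) : C := ((\sum_j b j)%N == N)%:R * g b.
rewrite -[RHS]/(x a) -(@boxed_sum _ _ N.+1 x).
  rewrite big_mkcond; apply: eq_bigr => t _; rewrite fockE /x.
  under [in RHS]eq_bigr do rewrite ffunE.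
  by case: ifP; rewrite ?mul0r ?mul1r.
move=> b bN; rewrite /x; case: eqP => [E|]; last by rewrite mul0r.
case/negP: bN; apply/forallP => j.
by rewrite ltnS -[X in (_ <= X)%N]E (bigD1 j)//= leq_addr.
Qed.

Lemma ket_powE m n (a : {ffun 'I_m -> nat}) : ket_pow R n a = [forall j, a j == n]%:R.
Proof. by rewrite -/(ket_diag R n a) ket_diagE. Qed.

Lemma PhiE m N a : @Phi R m N a = ((\sum_j a j)%N == N)%:R.
Proof.
rewrite -[RHS]mulr1 -(sum_fock N (fun=> 1)).
by apply: eq_bigr => t _; rewrite mul1r.
Qed.

Lemma PhiGHZE m N r a : @PhiGHZ R m N r a = core R N r a.
Proof.
by rewrite /PhiGHZ /core PhiE; congr (_ + _); apply: eq_bigr => n _; rewrite ket_powE.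
Qed.

Lemma is_core_PhiGHZ m N r : is_core (@PhiGHZ R m N r) N r.
Proof.
exists 1, (fun=> 1); split => [|n|a]; rewrite ?oner_neq0// PhiGHZE.
by rewrite /weight big1// !mul1r.
Qed.

Lemma is_core_Phi m N : is_core (@Phi R m N) N 0.
Proof.
have -> : @Phi R m N = @PhiGHZ R m N 0.
  by apply/funext => a; rewrite /PhiGHZ addn0 big_geq// addr0.
exact: is_core_PhiGHZ.
Qed.

Lemma complexr_neq0 (x : R) : x != 0 -> x%:C%C != 0.
Proof. by apply: contra => /eqP[->]. Qed.

Lemma sqrtr_prod (J : finType) (F : J -> R) : (forall j, 0 <= F j) ->
  Num.sqrt (\prod_j F j) = \prod_j Num.sqrt (F j).
Proof.
(* Nonnegativity of the partial products is carried through the induction for the product rule of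
   the square root. *)
move=> F0; suff [] : Num.sqrt (\prod_j F j) = \prod_j Num.sqrt (F j) /\
    0 <= \prod_j F j by [].
apply: (big_rec2 (fun x y => Num.sqrt y = x /\ 0 <= y)); first by rewrite sqrtr1 ler01.
by move=> j x y _ [<- y0]; rewrite sqrtrM// mulr_ge0.
Qed.

(** The root of the multinomial coefficient is sqrt(N!) times a product over modes, with weight
    [h n = 1 / sqrt(n!)]. *)
Lemma is_core_Psi m N : (0 < m)%N -> is_core (@Psi R m N) N 0.
Proof.
move=> m0.
have sq0 n : Num.sqrt (n`!%:R : R) != 0.
  by rewrite gt_eqF// sqrtr_gt0 ltr0n fact_gt0.
exists ((m%:R `^ (N%:R / 2%:R))^-1 * Num.sqrt (N`!%:R))%:C%C,
  (fun n => ((Num.sqrt n`!%:R)^-1)%:C%C); split.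
- apply: complexr_neq0; rewrite mulf_neq0// invr_eq0 gt_eqF//.
  by rewrite powR_gt0// ltr0n.
- by move=> n; apply: complexr_neq0; rewrite invr_eq0.
move=> a; rewrite /Psi rmorphM -mulrA; congr (_ * _).
rewrite /core addn0 big_geq// addr0 /weight -rmorph_prod mulrA -rmorphM mulrC.
transitivity (((\sum_j a j)%N == N)%:R *
  (Num.sqrt (N`!%:R / (\prod_j (a j)`!)%:R) : R)%:C%C).
  rewrite -(sum_fock N (fun a : {ffun 'I_m -> nat} =>
    (Num.sqrt (N`!%:R / (\prod_j (a j)`!)%:R) : R)%:C%C)).
  apply: eq_bigr => t _; congr ((Num.sqrt (_ / _%:R))%:C%C * _).
  by apply: eq_bigr => j _; rewrite ffunE.
congr (_ * _%:C%C).
rewrite sqrtrM ?ler0n// sqrtrV ?ler0n//; congr (_ * _).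
by rewrite prodfV natr_prod sqrtr_prod.
Qed.

(** The term |0 ... 0> is [Phi] at 0, which leaves r - 1 further diagonal terms. *)
Lemma is_core_GHZ m r : (0 < m)%N -> (0 < r)%N -> is_core (@GHZ R m r) 0 r.-1.
Proof.
move=> m0; case: r => // r _.
exists ((Num.sqrt r.+1%:R)^-1)%:C%C, (fun=> 1); split => [|n|a].
- by apply: complexr_neq0; rewrite invr_eq0 gt_eqF// sqrtr_gt0 ltr0n.
- exact: oner_neq0.
rewrite /GHZ [weight _ a]big1// mul1r; congr (_ * _).
rewrite big_ltn// /core add0n; congr (_ + _).
  by rewrite ket_powE sum_nat_eq0.
by apply: eq_bigr => n _; rewrite ket_powE.
Qed.

End DiagonalOperators.

Theorem mainTheorem8 (R : realType) (m : nat) (hm : (3 <= m)%N) :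
  (* (1) *)
  (forall N : nat,
     slocc (@Psi R m N) (@Phi R m N) /\
     in_class (@Psi R m N) (fun=> 1%N) /\
     in_class (@Phi R m N) (fun=> 1%N)) /\
  (* (2) *)
  (forall r : nat, (1 <= r)%N -> in_class (@GHZ R m r) (fun=> r)) /\
  (* (3) *)
  (forall N r : nat, (1 <= r)%N -> in_class (@PhiGHZ R m N r) (fun=> r.+1)) /\
  (* distinct representatives are SLOCC-inequivalent: within each family *)
  (forall N N' : nat, N <> N' ->
     ~ slocc (@Phi R m N) (@Phi R m N') /\
     ~ slocc (@Psi R m N) (@Psi R m N') /\
     ~ slocc (@Psi R m N) (@Phi R m N')) /\
  (forall r r' : nat, (1 <= r)%N -> (1 <= r')%N -> r <> r' ->
     ~ slocc (@GHZ R m r) (@GHZ R m r')) /\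
  (forall N r N' r' : nat, (1 <= r)%N -> (1 <= r')%N -> (N, r) <> (N', r') ->
     ~ slocc (@PhiGHZ R m N r) (@PhiGHZ R m N' r')) /\
  (* and across families, the excluded parameters being those for which the
     two representatives are the same state up to a scalar *)
  (forall N r : nat, (1 <= r)%N -> (N, r) <> (0%N, 1%N) ->
     ~ slocc (@Phi R m N) (@GHZ R m r) /\
     ~ slocc (@Psi R m N) (@GHZ R m r)) /\
  (forall N N' r : nat, (1 <= r)%N ->
     ~ slocc (@Phi R m N) (@PhiGHZ R m N' r) /\
     ~ slocc (@Psi R m N) (@PhiGHZ R m N' r)) /\
  (forall r N' r' : nat, (1 <= r)%N -> (1 <= r')%N ->
     (N', r) <> (0%N, r'.+1) ->
     ~ slocc (@GHZ R m r) (@PhiGHZ R m N' r')) /\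
  (* example *)
  (forall M : nat, (2 <= M)%N ->
     let chi := fun a => @Phi R m (M - 2)%N a + @ket_pow R m (M - 1)%N a in
     (has_schmidt_rank (@GHZ R m M) M /\
      has_schmidt_rank (@Psi R m (M - 1)%N) M /\
      has_schmidt_rank chi M) /\
     (in_class (@GHZ R m M) (fun=> M) /\
      in_class (@Psi R m (M - 1)%N) (fun=> 1%N) /\
      in_class chi (fun=> 2%N)) /\
     (~ slocc (@GHZ R m M) (@Psi R m (M - 1)%N) /\
      ~ slocc (@Psi R m (M - 1)%N) chi /\
      ((3 <= M)%N -> ~ slocc (@GHZ R m M) chi))).
Proof.
have hm0 : (0 < m)%N by exact: leq_trans hm.
have m3 : (2 < #|'I_m|)%N by rewrite card_ord.
(* From here each state is replaced by its parameters (N, r), and each inequivalence becomes an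
   arithmetic comparison of two such pairs. *)
have Psi_core N := @is_core_Psi R m N hm0.
have Phi_core N := @is_core_Phi R m N.
have GHZ_core r : (1 <= r)%N -> is_core (@GHZ R m r) 0 r.-1 by exact: is_core_GHZ.
have PG_core N r := @is_core_PhiGHZ R m N r.
have GHZ_class r : (1 <= r)%N -> in_class (@GHZ R m r) (fun=> r).
  by move=> r1; have := core_in_class m3 (GHZ_core r r1); rewrite prednK.
have Psi_class N := core_in_class m3 (Psi_core N).
split; [|split; [|split; [|split; [|split; [|split; [|split; [|split; [|split]]]]]]]].
- move=> N; split; last by split; [exact: Psi_class|exact: core_in_class (Phi_core N)].
  by apply: slocc_core (Psi_core N) (Phi_core N); rewrite card_ord.
- exact: GHZ_class.
- by move=> N r _; exact: core_in_class (PG_core N r).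
- move=> N N' NN'; split; [|split] => H; apply: NN'.
  + by have [] := slocc_core_inj m3 (Phi_core N) (Phi_core N') H.
  + by have [] := slocc_core_inj m3 (Psi_core N) (Psi_core N') H.
  + by have [] := slocc_core_inj m3 (Psi_core N) (Phi_core N') H.
- move=> r r' r1 r1' rr' H; apply: rr'.
  by have [_] := slocc_core_inj m3 (GHZ_core r r1) (GHZ_core r' r1') H; lia.
- move=> N r N' r' _ _ Nr H; apply: Nr.
  by have [-> ->] := slocc_core_inj m3 (PG_core N r) (PG_core N' r') H.
- move=> N r r1 Nr; split=> H; apply: Nr.
  + have [-> E] := slocc_core_inj m3 (Phi_core N) (GHZ_core r r1) H.
    by congr pair; lia.
  + have [-> E] := slocc_core_inj m3 (Psi_core N) (GHZ_core r r1) H.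
    by congr pair; lia.
- move=> N N' r r1; split=> H.
  + by have [_] := slocc_core_inj m3 (Phi_core N) (PG_core N' r) H; lia.
  + by have [_] := slocc_core_inj m3 (Psi_core N) (PG_core N' r) H; lia.
- move=> r N' r' r1 _ Nr H; apply: Nr.
  have [<- E] := slocc_core_inj m3 (GHZ_core r r1) (PG_core N' r') H.
  by congr pair; lia.
move=> M M2 chi; have M1 : (1 <= M)%N by exact: leq_trans M2.
have chi_core : is_core chi (M - 2) 1.
  have -> : chi = @PhiGHZ R m (M - 2) 1.
    apply/funext => a; rewrite /chi /PhiGHZ addn1 big_nat1.
    by congr (_ + ket_pow _ _ a); lia.
  exact: PG_core.
have rank_eq psi n n' : n = n' -> @has_schmidt_rank R 'I_m psi n -> has_schmidt_rank psi n'.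
  by move=> ->.
split; [|split].
- split; [|split].
  + by apply: rank_eq (core_schmidt_rank (GHZ_core M M1)); lia.
  + by apply: rank_eq (core_schmidt_rank (Psi_core (M - 1)%N)); lia.
  + by apply: rank_eq (core_schmidt_rank chi_core); lia.
- split; [exact: GHZ_class|split; [exact: Psi_class|exact: core_in_class chi_core]].
split=> [H|].
  by have [] := slocc_core_inj m3 (GHZ_core M M1) (Psi_core (M - 1)%N) H; lia.
split=> [H|M3 H].
  by have [] := slocc_core_inj m3 (Psi_core (M - 1)%N) chi_core H; lia.
(* The pairs are (0, M - 1) and (M - 2, 1); they coincide at M = 2, hence the bound 3 <= M. *)
by have [] := slocc_core_inj m3 (GHZ_core M M1) chi_core H; lia.
Qed.
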